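(* Every free nilpotent group of class $c\geq 3$ and rank at least $2$ is chiral, and the free nilpotent group of rank $3$ and class $2$ is achiral.
   Context: The free nilpotent group of class $c$ and rank $r$ is $F/\gamma_{c+1}(F)$, where $F$ is the free group of rank $r$ and $\gamma_i$ denotes the lower central series ($\gamma_1(F)=F$, $\gamma_{i+1}(F)=[\gamma_i(F),F]$). A word $w$ in $k$ variables is an element of the free group on $x_1,\dots,x_k$. For a group $G$, $w$ induces by evaluation a map $w:G^{(k)}\to G$, where $G^{(k)}$ is the direct product of $k$ copies of $G$; its image is denoted $G_w$ (not assumed closed under inverses). A pair $(G,w)$ is chiral if $G_w\neq G_{w^{-1}}$, equivalently if the set of inverses of elements of $G_w$ is not equal to $G_w$. A group $G$ is chiral if $(G,w)$ is chiral for some word $w$; otherwise $G$ is achiral. *)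

(* Defs.v *)
From HB Require Import structures.
From mathcomp Require Import all_boot.
From mathcomp Require Import boolp classical_sets.

Set Implicit Arguments.
Unset Strict Implicit.
Unset Printing Implicit Defensive.

Local Open Scope classical_set_scope.
Local Open Scope group_scope.
Local Open Scope quotient_scope.

Section ReducedWords.
Variable X : choiceType.

(* The letter (x, false) stands for x and (x, true) for x^-1. *)
Local Notation letter := (X * bool)%type.

Definition letter_inv (a : letter) : letter := (a.1, ~~ a.2).

Definition reduced (s : seq letter) : bool :=
  sorted (fun a b => b != letter_inv a) s.

Definition push (a : letter) (s : seq letter) : seq letter :=
  if s is b :: s' then (if b == letter_inv a then s' else a :: s) else [:: a].

Definition reduce (s : seq letter) : seq letter := foldr push [::] s.

Lemma letter_invK : involutive letter_inv.
Proof. by case=> x b; rewrite /letter_inv /= negbK. Qed.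

Lemma push_reduced a s : reduced s -> reduced (push a s).
Proof.
case: s => [|b s] //= Hs; case: ifP => [_|/negbT Hb /=]; last by rewrite Hb.
exact: path_sorted Hs.
Qed.

Lemma foldr_push_reduced s t : reduced t -> reduced (foldr push t s).
Proof. by move=> Ht; elim: s => //= a s; apply: push_reduced. Qed.

Lemma reduce_reduced s : reduced (reduce s).
Proof. exact: foldr_push_reduced. Qed.

Lemma pushK a s : reduced s -> push a (push (letter_inv a) s) = s.
Proof.
case: s => [|b s] /=; first by rewrite eqxx.
rewrite letter_invK; case: eqP => [-> {b}|_ _] /=; last by rewrite eqxx.
by case: s => [|b s] //= /andP[/negbTE-> _].
Qed.

Lemma foldr_push_push a s t :
  reduced t -> foldr push t (push a s) = push a (foldr push t s).
Proof.
move=> Ht; case: s => [|b s] //=.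
by case: eqP => [->|//]; rewrite pushK // foldr_push_reduced.
Qed.

Lemma foldr_push_foldr s r t : reduced t ->
  foldr push t (foldr push r s) = foldr push (foldr push t r) s.
Proof. by move=> Ht; elim: s => //= a s IHs; rewrite foldr_push_push // IHs. Qed.

Lemma reduce_id s : reduced s -> reduce s = s.
Proof.
elim: s => //= a s IHs Has; rewrite IHs; last exact: path_sorted Has.
by case: s Has {IHs} => //= b s /andP[/negbTE-> _].
Qed.

End ReducedWords.

(* The free group with basis X; its rank is the cardinality of X. *)
Record free_group (X : choiceType) : Type :=
  FreeGroup { free_word : seq (X * bool); free_wordP : reduced free_word }.

Section FreeGroup.
Variable X : choiceType.
Implicit Types u v w : free_group X.

HB.instance Definition _ := [isSub for @free_word X].
HB.instance Definition _ := [Choice of free_group X by <:].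

Definition free_of_seq (s : seq (X * bool)) : free_group X :=
  FreeGroup (reduce_reduced s).
Definition free_gen (x : X) : free_group X := free_of_seq [:: (x, false)].
Definition free_one : free_group X := free_of_seq [::].
Definition free_mul u v : free_group X :=
  free_of_seq (free_word u ++ free_word v).
Definition free_inv u : free_group X :=
  free_of_seq (rev (map (@letter_inv X) (free_word u))).

Lemma free_mulE u v :
  free_word (free_mul u v) = foldr (@push X) (free_word v) (free_word u).
Proof.
by rewrite /= /reduce foldr_cat -/(reduce _) reduce_id ?free_wordP.
Qed.

Lemma free_mulA : associative free_mul.
Proof.
move=> u v w; apply: (@val_inj _ _ (free_group X)).
rewrite [LHS]free_mulE [RHS]free_mulE !free_mulE.
by rewrite foldr_push_foldr ?free_wordP.
Qed.

Lemma free_mul1 : left_id free_one free_mul.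
Proof. by move=> u; apply: val_inj; rewrite [LHS]free_mulE. Qed.

Lemma free_mulr1 : right_id free_one free_mul.
Proof. by move=> u; apply: val_inj; rewrite /= cats0 reduce_id ?free_wordP. Qed.

Lemma free_mulV : left_inverse free_one free_inv free_mul.
Proof.
move=> u; apply: val_inj; rewrite [LHS]free_mulE /= /reduce.
rewrite foldr_push_foldr ?free_wordP //=; case: u => /= s.
elim: s => //= a s IHs Has; rewrite rev_cons -cats1 foldr_cat /=.
have Hs : reduced s by apply: path_sorted Has.
rewrite -[RHS]IHs //; congr foldr.
by rewrite letter_invK eqxx.
Qed.

Lemma free_mulrV : right_inverse free_one free_inv free_mul.
Proof.
move=> u; rewrite -[LHS]free_mul1 -(free_mulV (free_inv u)) -free_mulA.
by rewrite (free_mulA (free_inv u)) free_mulV free_mul1.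
Qed.

HB.instance Definition _ := isGroup.Build (free_group X)
  free_mulA free_mul1 free_mulr1 free_mulV free_mulrV.

End FreeGroup.

Section Evaluation.
Variables (X : choiceType) (G : groupType) (f : X -> G).

Definition letter_eval (a : X * bool) : G :=
  if a.2 then (f a.1)^-1 else f a.1.

(* The homomorphism free_group X -> G that extends f. *)
Definition free_eval (w : free_group X) : G :=
  \prod_(a <- free_word w) letter_eval a.

Lemma letter_evalV a : letter_eval (letter_inv a) = (letter_eval a)^-1.
Proof. by case: a => x [] //=; rewrite /letter_eval /= invgK. Qed.

Lemma prod_foldr_push s t :
  \prod_(a <- foldr (@push X) t s) letter_eval a =
    (\prod_(a <- s) letter_eval a) * \prod_(a <- t) letter_eval a.
Proof.
elim: s => [|a s IHs] /=; first by rewrite big_nil mul1g.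
rewrite big_cons -mulgA -IHs; case: (foldr _ _ _) => [|b r] /=.
  by rewrite big_seq1 big_nil mulg1.
case: eqP => [->|_]; last by rewrite big_cons.
by rewrite big_cons letter_evalV mulVKg.
Qed.

Lemma free_evalM : {morph free_eval : u v / u * v}.
Proof.
by move=> u v; rewrite /free_eval [free_word (_ * _)]free_mulE prod_foldr_push.
Qed.

Lemma free_eval1 : free_eval 1 = 1.
Proof. by rewrite /free_eval big_nil. Qed.

HB.instance Definition _ :=
  isUMagmaMorphism.Build (free_group X) G free_eval (conj free_eval1 free_evalM).

Lemma free_eval_gen x : free_eval (free_gen x) = f x.
Proof. by rewrite /free_eval /= big_seq1. Qed.

Lemma free_eval_unique (h : free_group X -> G) :
  {morph h : u v / u * v} -> (forall x, h (free_gen x) = f x) ->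
  h =1 free_eval.
Proof.
move=> hM hf; have h1 : h 1 = 1 by apply: (@mulgI _ (h 1)); rewrite -hM !mulg1.
have hV u : h u^-1 = (h u)^-1.
  by apply: (@mulgI _ (h u)); rewrite -hM !mulgV.
case=> s Hs; rewrite /free_eval /=.
elim: s Hs => [|[x b] s IHs] Hs.
  by rewrite big_nil -[RHS]h1; congr h; apply: (@val_inj _ _ (free_group X)).
have Hs' : reduced s by apply: path_sorted Hs.
have -> : FreeGroup Hs =
    (if b then (free_gen x)^-1 else free_gen x) * FreeGroup Hs'.
  apply: (@val_inj _ _ (free_group X)); rewrite [RHS]free_mulE.
  by case: b Hs; case: s {IHs} Hs' => //= a s _ /andP[/negbTE-> _].
by rewrite hM IHs big_cons /letter_eval; case: b {Hs}; rewrite /= ?hV hf.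
Qed.

End Evaluation.

Section Subgroups.
Variable G : groupType.
Implicit Types A B H N : set G.

Definition subgroup H : Prop :=
  H 1 /\ (forall x y, H x -> H y -> H (x / y)).

Definition normal_in H : Prop :=
  forall x y, H x -> H (x ^ y).

Definition generated A : set G := smallest subgroup A.

Definition commutator_subgroup A B : set G :=
  generated [set [~ x, y] | x in A & y in B].

(* Indexed from 1: lower_central 1 is the whole group; the value at 0 is
   irrelevant. *)
Definition lower_central (i : nat) : set G :=
  iter i.-1 (commutator_subgroup ^~ setT) setT.

Lemma lower_central1 : lower_central 1 = setT. Proof. by []. Qed.

Lemma lower_centralS i : (0 < i)%N ->
  lower_central i.+1 = commutator_subgroup (lower_central i) setT.
Proof. by case: i. Qed.

Lemma generated_subgroup A : subgroup (generated A).
Proof.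
split=> [H [[H1 _] _] // | x y Ax Ay H HA].
by case: (HA) => -[_ HF] _; apply: HF; [exact: Ax | exact: Ay].
Qed.

Lemma generated_normal A : normal_in A -> normal_in (generated A).
Proof.
move=> nA x y Ax H [[H1 HF] AH].
suff : [set z | H (z ^ y)] x by [].
apply: Ax; split; last by move=> z Az; apply: AH; apply: nA.
split=> [|u v Hu Hv] /=; first by rewrite conj1g.
by rewrite conjMg conjVg; apply: HF.
Qed.

Lemma commutator_normal A : normal_in A -> normal_in (commutator_subgroup A setT).
Proof.
move=> nA; apply: generated_normal => _ y [a Aa [b _ <-]].
by rewrite conjRg; exists (a ^ y); [exact: nA | exists (b ^ y)].
Qed.

Lemma lower_central_subgroup i : subgroup (lower_central i).
Proof.
by rewrite /lower_central; case: i.-1 => [|n] //=; exact: generated_subgroup.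
Qed.

Lemma lower_central_normal i : normal_in (lower_central i).
Proof.
by rewrite /lower_central; elim: i.-1 => [|n IHn] //=; exact: commutator_normal.
Qed.

End Subgroups.

Record normal_subgroup (G : groupType) := NormalSubgroup {
  nsg_set :> set G;
  nsg_subgroup : subgroup nsg_set;
  nsg_normal : normal_in nsg_set
}.

Section Quotient.
Variables (G : groupType) (N : normal_subgroup G).

Definition same_coset (x y : G) : bool := `[< (N : set G) (x^-1 * y) >].

Lemma same_coset_equiv : equiv_class_of same_coset.
Proof.
have [N1 NF] := nsg_subgroup N.
have NV x : (N : set G) x -> (N : set G) x^-1.
  by move=> Nx; rewrite -[_^-1]mul1g; apply: NF.
split=> [x | x y | y x z].
- by apply/asboolP; rewrite mulVg.
- by apply/asboolP/asboolP => /NV; rewrite invgM invgK.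
- move=> /asboolP Nxy /asboolP Nyz; apply/asboolP.
  by rewrite -(mulVKg y z) mulgA -[y^-1 * z]invgK; apply: NF => //; apply: NV.
Qed.

Canonical same_coset_equivRel := EquivRelPack same_coset_equiv.

Definition quotient : Type := {eq_quot same_coset}.
HB.instance Definition _ := Choice.on quotient.
HB.instance Definition _ := EqQuotient.on quotient.

Definition quo_one : quotient := lift_cst quotient 1.
Definition quo_mul := lift_op2 quotient (@mul G).
Definition quo_inv := lift_op1 quotient (@inv G).

Canonical pi_quo_one := PiConst quo_one.

Lemma same_cosetM (x x' y y' : G) :
  same_coset x x' -> same_coset y y' -> same_coset (x * y) (x' * y').
Proof.
move=> /asboolP Nx /asboolP Ny; apply/asboolP.
have [N1 NF] := nsg_subgroup N.
have -> : (x * y)^-1 * (x' * y') = (x^-1 * x') ^ y / (y^-1 * y')^-1.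
  by rewrite invgK conjgE invgM !mulgA mulgK.
apply: (NF); first exact: nsg_normal.
by rewrite -[_^-1]mul1g; apply: NF.
Qed.

Lemma same_cosetV (x y : G) : same_coset x y -> same_coset x^-1 y^-1.
Proof.
move=> /asboolP Nxy; apply/asboolP; have [N1 NF] := nsg_subgroup N.
have -> : x^-1^-1 * y^-1 = 1 / ((x^-1 * y) ^ x^-1).
  by rewrite mul1g conjgE !invgK -mulgA mulVKg invgM invgK.
by apply: NF => //; exact: nsg_normal.
Qed.

Lemma pi_quo_mul : {morph \pi_quotient : x y / (x * y) >-> quo_mul x y}.
Proof.
move=> x y; unlock quo_mul; apply/eqmodP/same_cosetM; apply/eqmodP;
  by rewrite reprK.
Qed.
Canonical pi_quo_mul_morph := PiMorph2 pi_quo_mul.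

Lemma pi_quo_inv : {morph \pi_quotient : x / x^-1 >-> quo_inv x}.
Proof.
by move=> x; unlock quo_inv; apply/eqmodP/same_cosetV/eqmodP; rewrite reprK.
Qed.
Canonical pi_quo_inv_morph := PiMorph1 pi_quo_inv.

Lemma quo_mulA : associative quo_mul.
Proof. by do 3!elim/quotW=> ?; rewrite !piE mulgA. Qed.

Lemma quo_mul1 : left_id quo_one quo_mul.
Proof. by elim/quotW=> x; rewrite !piE mul1g. Qed.

Lemma quo_mulr1 : right_id quo_one quo_mul.
Proof. by elim/quotW=> x; rewrite !piE mulg1. Qed.

Lemma quo_mulV : left_inverse quo_one quo_inv quo_mul.
Proof. by elim/quotW=> x; rewrite !piE mulVg. Qed.

Lemma quo_mulrV : right_inverse quo_one quo_inv quo_mul.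
Proof. by elim/quotW=> x; rewrite !piE mulgV. Qed.

HB.instance Definition _ := isGroup.Build quotient
  quo_mulA quo_mul1 quo_mulr1 quo_mulV quo_mulrV.

Definition quo_pi (x : G) : quotient := \pi_quotient x.

Lemma quo_pi_monoid_morphism : monoid_morphism quo_pi.
Proof.
split=> [|x y]; first by rewrite /quo_pi -[1 in RHS]/quo_one !piE.
exact: pi_quo_mul.
Qed.

HB.instance Definition _ :=
  isUMagmaMorphism.Build G quotient quo_pi quo_pi_monoid_morphism.

Lemma quo_pi_surj (q : quotient) : exists x, quo_pi x = q.
Proof. by exists (repr q); exact: reprK. Qed.

Lemma quo_pi_eq1 (x : G) : quo_pi x = 1 <-> (N : set G) x.
Proof.
have <- : quo_pi 1 = 1 by case: quo_pi_monoid_morphism.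
split=> [/esym/eqmodP/asboolP | Nx]; first by rewrite invg1 mul1g.
by apply/esym/eqmodP/asboolP; rewrite invg1 mul1g.
Qed.

End Quotient.

Definition lower_central_nsg (G : groupType) (i : nat) : normal_subgroup G :=
  NormalSubgroup (@lower_central_subgroup G i) (@lower_central_normal G i).

Definition free_nilpotent (X : choiceType) (c : nat) : groupType :=
  quotient (lower_central_nsg (free_group X) c.+1).

(* The set G_w of values of the word w in the variables x_0, ..., x_(k-1). *)
Definition word_image (G : groupType) (k : nat) (w : free_group 'I_k) : set G :=
  [set free_eval g w | g in [set: 'I_k -> G]].
Arguments word_image G {k} w.

Definition chiral_pair (G : groupType) (k : nat) (w : free_group 'I_k) : Prop :=
  word_image G w <> word_image G w^-1.
Arguments chiral_pair G {k} w.

Definition chiral (G : groupType) : Prop :=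
  exists (k : nat) (w : free_group 'I_k), chiral_pair G w.

Definition achiral (G : groupType) : Prop := ~ chiral G.

(* Main.v *)
Require Import Defs.
From HB Require Import structures.
From mathcomp Require Import all_boot all_algebra.
From mathcomp Require Import zify ring.
From mathcomp Require Import boolp classical_sets.

(** The two halves rest on explicit integer models of nilpotent groups.

    Chirality.  If a homomorphism from the free group kills the relevant term
    of the lower central series, then any equality of word images in the free
    nilpotent group is transported to the target group.  So it is enough to
    exhibit one group H of class 3 and a word w one of whose values in H has an
    inverse that is not a value of w in H (chiral_free_nilpotent).  Here
    w = x^9 [x, y]^3 [[x, y], x], and H is the semidirect product by Z of the
    lattice spanned by 1, e, e^2/2 in Q[e]/(e^3), the generator of Z acting as
    multiplication by exp e (shear).  If
    w(g, h) = w(x, y)^-1, the x^9 part forces g to have Z-coordinate -1 and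
    constant coefficient 0; the e-coefficient, divided by 3, forces the
    constant coefficient of h to be 1 modulo 3; and modulo 3 the e^2-coefficient
    only sees [[x, y], x], which is quadratic in g, hence does not change sign
    with it: this forces 1 = -1 modulo 3.

    Achirality.  It is enough that every element v of the free nilpotent group
    of rank 3 and class 2 is sent to its inverse by an endomorphism, since
    endomorphisms map values of a word to values of it (inverting_substitution,
    word_image_inv_sub).  That group embeds in a group with underlying set
    Z^3 x Lambda^2 Z^3 (wedge), in which v is a pair (a, p).  In rank 3 each
    bivector p is decomposable, so the y with y /\ p = 0 form a lattice of rank
    at least 2, which leaves room for such a vector y and a covector l with
    l(y) = 1 and l(a) = 0 (bezout_orthogonal3).  The linear map
    M = -1 + 2 y l, which fixes y and negates the kernel of l, satisfies M a = -a
    and (Lambda^2 M) p = -p, so it inverts v.  Since M = -1 modulo 2, the images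
    of the basis stay in the image of the free group, so M is induced by a
    substitution (reflection_basis_lift).  Going back from the model to the free
    nilpotent group requires the model to be faithful (wedge_faithful), which
    follows from collecting words into a normal form. *)

Set Implicit Arguments.
Unset Strict Implicit.
Unset Printing Implicit Defensive.

Import GRing.Theory.
Local Open Scope ring_scope.
Local Open Scope group_scope.

(** * Homomorphisms from free and free nilpotent groups *)

Lemma free_eval_comp (X : choiceType) (G H : groupType)
    (h : UMagmaMorphism.type G H) (f : X -> G) (u : free_group X) :
  free_eval (h \o f) u = h (free_eval f u).
Proof.
apply/esym/(free_eval_unique (h := h \o free_eval f)) => [v w|x] /=.
  by rewrite free_evalM gmulfM.
by rewrite free_eval_gen.
Qed.

(** A descending central series of the target contains the image of the lower
    central series. *)
Lemma lower_central_image (G H : groupType) (h : UMagmaMorphism.type G H)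
    (A : nat -> set H) :
  (forall y, A 1%N y) -> (forall i, subgroup (A i)) ->
  (forall i x y, (0 < i)%N -> A i x -> A i.+1 [~ x, y]) ->
  forall i u, (0 < i)%N -> lower_central i u -> A i (h u).
Proof.
move=> A1 Asub AR; elim=> [//|[|i] IHi] u _; first by move=> _; apply: A1.
rewrite lower_centralS // => /(_ (fun v => A i.+2 (h v))); apply; split.
  split=> [|v w Av Aw] /=; first by rewrite gmulf1; case: (Asub i.+2).
  by rewrite gmulfF; apply: (Asub i.+2).2.
by move=> _ [v Lv [w _ <-]] /=; rewrite gmulfR; apply: AR => //; apply: IHi.
Qed.

(** Chirality needs only a homomorphism to a group H, not necessarily onto: any
    solution of w(g') = w(x)^-1 in the free nilpotent group would be mapped to
    one in H. *)
Lemma chiral_free_nilpotent (X : choiceType) (c : nat) (H : groupType)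
    (h : X -> H) (k : nat) (w : free_group 'I_k) (g : 'I_k -> X) :
  (forall u, lower_central c.+1 u -> free_eval h u = 1) ->
  (forall g' : 'I_k -> H, free_eval (h \o g) w <> free_eval g' w^-1) ->
  chiral (free_nilpotent X c).
Proof.
move=> hL hw; exists k, w => eqw.
set N := lower_central_nsg (free_group X) c.+1.
have: word_image (free_nilpotent X c) w
    (free_eval (@quo_pi _ N \o (@free_gen X \o g)) w) by eexists.
rewrite eqw => -[g' _]; rewrite free_eval_comp.
have {g'} [u /funext->] : exists u : 'I_k -> free_group X,
    forall i, g' i = quo_pi N (u i).
  have [u hu] := choice (fun i => quo_pi_surj (g' i)).
  by exists u => i; rewrite hu.
rewrite free_eval_comp => /esym.
move=> /(congr1 (fun q => q^-1 * quo_pi N (free_eval u w^-1))).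
rewrite mulVg -gmulfV -gmulfM => /(@quo_pi_eq1 _ N) /hL.
rewrite gmulfM gmulfV -!free_eval_comp => /mulg1_eq; rewrite invgK.
rewrite (_ : _ \o (_ \o g) = h \o g); last first.
  by apply: funext => i /=; rewrite free_eval_gen.
exact: hw.
Qed.

(** * A chiral group of class 3 *)

(** The tuple (i, a, b, c) is the product of a + b e + c e^2/2 in Q[e]/(e^3) and
    the i-th power of an element that acts as multiplication by exp e.  Taking
    e^2/2 as a basis vector makes exp (i e) = 1 + i e + i^2 e^2/2 integral. *)
Definition shear : Type := (int * int * int * int)%type.
HB.instance Definition _ := Choice.on shear.

Definition shear_mul (g h : shear) : shear :=
  let: (i, a, b, c) := g in let: (j, a', b', c') := h in
  (i + j, a + a', b + b' + i * a', c + c' + 2 * i * b' + i * i * a')%R.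
Definition shear_inv (g : shear) : shear :=
  let: (i, a, b, c) := g in
  (- i, - a, i * a - b, 2 * i * b - i * i * a - c)%R.

Lemma shear_mulA : associative shear_mul.
Proof.
by move=> [[[i a] b] c] [[[j a'] b'] c'] [[[l a''] b''] c''];
  congr (_, _, _, _); ring.
Qed.

Lemma shear_mul1 : left_id (0, 0, 0, 0)%R shear_mul.
Proof. by move=> [[[i a] b] c]; congr (_, _, _, _); ring. Qed.

Lemma shear_mulr1 : right_id (0, 0, 0, 0)%R shear_mul.
Proof. by move=> [[[i a] b] c]; congr (_, _, _, _); ring. Qed.

Lemma shear_mulV : left_inverse (0, 0, 0, 0)%R shear_inv shear_mul.
Proof. by move=> [[[i a] b] c]; congr (_, _, _, _); ring. Qed.

Lemma shear_mulrV : right_inverse (0, 0, 0, 0)%R shear_inv shear_mul.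
Proof. by move=> [[[i a] b] c]; congr (_, _, _, _); ring. Qed.

HB.instance Definition _ := isGroup.Build shear
  shear_mulA shear_mul1 shear_mulr1 shear_mulV shear_mulrV.

(** Contains the n-th term of the lower central series for 0 < n; commutators
    with elements acting as exp (i e) multiply by multiples of e. *)
Definition shear_term (n : nat) (g : shear) : Prop :=
  let: (i, a, b, c) := g in
  [/\ (1 < n)%N -> i = 0%R /\ a = 0%R, (2 < n)%N -> b = 0%R
    & (3 < n)%N -> c = 0%R].

Lemma shear_term_subgroup n : subgroup (shear_term n).
Proof.
split=> // -[[[i a] b] c] [[[j a'] b'] c'] [Ha Hb Hc] [Ha' Hb' Hc'].
split=> [n1|n2|n3].
- have [i0 a0] := Ha n1; have [j0 a'0] := Ha' n1.
  by rewrite i0 a0 j0 a'0; split; ring.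
- have [i0 a0] := Ha (ltnW n2); have [j0 a'0] := Ha' (ltnW n2).
  by rewrite i0 j0 Hb // Hb' //; ring.
- have [i0 a0] := Ha (ltnW (ltnW n3)); have [j0 a'0] := Ha' (ltnW (ltnW n3)).
  by rewrite i0 j0 Hc // Hc' //; ring.
Qed.

Lemma shear_commE (i a b c j a' b' c' : int) :
  [~ ((i, a, b, c) : shear), ((j, a', b', c') : shear)] =
    (0, 0, i * a' - j * a,
      - (i * i + 2 * i * j) * a' + (j * j + 2 * i * j) * a
      + 2 * i * b' - 2 * j * b)%R.
Proof. by congr (_, _, _, _); ring. Qed.

Lemma shear_term_comm n g h :
  (0 < n)%N -> shear_term n g -> shear_term n.+1 [~ g, h].
Proof.
case: g h => [[[i a] b] c] [[[j a'] b'] c'] n0 [Ha Hb Hc].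
rewrite shear_commE; split=> // [n1|n2].
  by have [-> ->] := Ha n1; ring.
by have [-> ->] := Ha (ltnW n2); rewrite Hb //; ring.
Qed.

(** The exponents 9, 3, 1 separate three scales: modulo 3 the last factor is
    seen alone, and modulo 9 the first one disappears from the e- and
    e^2-coefficients if x has constant coefficient 0. *)
Definition witness : free_group 'I_2 :=
  free_gen ord0 ^+ 9 * ([~ free_gen ord0, free_gen ord_max] ^+ 3
    * [~ [~ free_gen ord0, free_gen ord_max], free_gen ord0]).

Lemma witness_eval (G : groupType) (f : 'I_2 -> G) :
  free_eval f witness =
    f ord0 ^+ 9 * ([~ f ord0, f ord_max] ^+ 3
      * [~ [~ f ord0, f ord_max], f ord0]).
Proof.
rewrite gmulfM gmulfXn gmulfM gmulfXn !gmulfR.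
by rewrite /= !free_eval_gen.
Qed.

Lemma shear_exp3 (b c : int) :
  ((0, 0, b, c)%R : shear) ^+ 3 = (0, 0, 3 * b, 3 * c)%R.
Proof. by congr (_, _, _, _); ring. Qed.

Lemma shear_exp9 (i a b c : int) :
  ((i, a, b, c) : shear) ^+ 9 =
    (9 * i, 9 * a, 9 * b + 36 * i * a, 9 * c + 72 * i * b + 204 * i * i * a)%R.
Proof. by congr (_, _, _, _); ring. Qed.

Lemma shear_mulE (i a b c j a' b' c' : int) :
  ((i, a, b, c) : shear) * ((j, a', b', c') : shear) =
  (i + j, a + a', b + b' + i * a', c + c' + 2 * i * b' + i * i * a')%R.
Proof. by []. Qed.

(** Of the two given generators, the first goes to the element acting as exp e,
    the second to the unit of Q[e]/(e^3); all others go to 1. *)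
Lemma free_nilpotent_chiral (X : choiceType) (c : nat) :
  (exists x y : X, x <> y) -> (3 <= c)%N -> chiral (free_nilpotent X c).
Proof.
move=> [x [y xy]] c3.
pose h (z : X) : shear :=
  if z == x then (1, 0, 0, 0)%R
  else if z == y then (0, 1, 0, 0)%R else (1 : shear).
apply: (@chiral_free_nilpotent _ _ shear h 2 witness
  (fun i => if i == ord0 then x else y)) => [u|g].
  have shear1 g : shear_term 1%N g by case: g => [[[? ?] ?] ?].
  move=> Lu; have := lower_central_image (free_eval h) shear1
    shear_term_subgroup shear_term_comm (ltn0Sn c) Lu.
  rewrite /=; case: (free_eval h u) => [[[i a] b] d] [ad bd dd].
  have [-> ->] := ad (ltnW (ltnW c3)).
  by rewrite bd ?dd // ltnW.
rewrite gmulfV !witness_eval /= /h !eqxx.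
have /negbTE-> : y != x by apply/eqP => /esym.
rewrite witness_eval.
case: (g ord0) => [[[i a] b] d]; case: (g _) => [[[j a'] b'] d'].
rewrite !shear_commE !shear_exp9 !shear_exp3 !shear_mulE.
case=> Ei Ea Eb Ed.
have i_m1 : i = (-1)%R by lia.
have a0 : a = 0%R by lia.
move: Eb Ed; rewrite i_m1 a0 => Eb Ed.
(* Eb says a' = 1 + 3 b, and then Ed reads -2 = 2 modulo 3. *)
lia.
Qed.

(** * Integer powers in a group *)

Definition zexpg (G : groupType) (x : G) (n : int) : G :=
  match n with Posz m => x ^+ m | Negz m => x ^- m.+1 end.

Section IntegerPowers.
Variable G : groupType.
Implicit Types (x y : G) (n : int).

Lemma zexpgS x n : zexpg x (n + 1) = zexpg x n * x.
Proof.
case: n => [m|[|m]] /=; first by rewrite addn1 expgSr.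
  by rewrite mulVg.
by rewrite subn1 /= [x ^+ m.+2]expgS invgM mulgVK.
Qed.

Lemma zexpgB1 x n : zexpg x (n - 1) = zexpg x n / x.
Proof. by rewrite -{2}[n](@subrK _ 1%R) zexpgS mulgK. Qed.

Lemma zexpgM x y n : commute x y -> zexpg (x * y) n = zexpg x n * zexpg y n.
Proof.
move=> xy; case: n => m /=; first exact: expgMn.
by rewrite -invgM -expgMn // xy.
Qed.

Lemma zexpgJ x y n : (zexpg x n) ^ y = zexpg (x ^ y) n.
Proof. by case: n => m /=; rewrite ?conjVg conjXg. Qed.

Lemma zexpgV x n : zexpg x^-1 n = zexpg x (- n)%R.
Proof. by case: n => [[|m]|m] //=; rewrite expVgn ?invg1 ?invgK. Qed.

Lemma zexpgD x m n : zexpg x (m + n) = zexpg x m * zexpg x n.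
Proof.
elim/int_rect: n => [|n IHn|n IHn].
- by rewrite addr0 mulg1.
- by rewrite -addn1 PoszD addrA !zexpgS IHn mulgA.
- by rewrite -addn1 PoszD opprD addrA !zexpgB1 IHn mulgA.
Qed.

Lemma commute_zexpg x y n : commute x y -> commute x (zexpg y n).
Proof. by case: n => m xy /=; [|apply: commuteV]; apply: commuteX. Qed.

End IntegerPowers.

Lemma zexpg_morph (G H : groupType) (h : UMagmaMorphism.type G H) (x : G) n :
  h (zexpg x n) = zexpg (h x) n.
Proof. by case: n => m /=; rewrite ?gmulfV gmulfXn. Qed.

(** * Collection in groups of class 2 *)

Definition class2 (G : groupType) : Prop :=
  forall x y z : G, commute [~ x, y] z.

Section Class2.
Variables (G : groupType) (G2 : class2 G).
Implicit Types x y z : G.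

Lemma class2_zexpg_mul x y n : zexpg y n * x = x * zexpg y n * zexpg [~ y, x] n.
Proof.
rewrite conjgC zexpgJ -mulgA -zexpgM; last exact/commute_sym/G2.
by rewrite -[[~ y, x]]/(_ * _) mulVKg.
Qed.

(** In class 2 the map [~ y, _] is a homomorphism. *)
Lemma class2_commgV x y : [~ y, x^-1] = [~ y, x]^-1.
Proof.
have fixR : [~ y, x] ^ x^-1 = [~ y, x] by rewrite conjgE G2 mulKg.
have /(canRL (mulgK _)) yV : y ^ x^-1 * [~ y, x] = y.
  by rewrite -[X in _ * X]fixR -conjMg mulVKg conjgK.
by rewrite commgEl yV mulKg.
Qed.

End Class2.

Definition i1 : 'I_3 := @Ordinal 3 0 isT.
Definition i2 : 'I_3 := @Ordinal 3 1 isT.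
Definition i3 : 'I_3 := @Ordinal 3 2 isT.

Lemma ord3P (i : 'I_3) : [\/ i = i1, i = i2 | i = i3].
Proof.
case: i => [[|[|[|//]]] ltm]; [constructor 1|constructor 2|constructor 3];
  exact: val_inj.
Qed.

(** The commutators are taken with decreasing indices because collecting moves
    the generators of small index to the left. *)
Definition normal_form (G : groupType) (f : 'I_3 -> G)
    (a1 a2 a3 q21 q31 q32 : int) : G :=
  zexpg (f i1) a1 * zexpg (f i2) a2 * zexpg (f i3) a3 *
  (zexpg [~ f i2, f i1] q21 * zexpg [~ f i3, f i1] q31 *
   zexpg [~ f i3, f i2] q32).

Lemma normal_form_morph (G H : groupType) (h : UMagmaMorphism.type G H)
    (f : 'I_3 -> G) a1 a2 a3 q21 q31 q32 :
  h (normal_form f a1 a2 a3 q21 q31 q32) =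
  normal_form (h \o f) a1 a2 a3 q21 q31 q32.
Proof. by rewrite /normal_form !gmulfM !zexpg_morph !gmulfR. Qed.

Section Collection.
Variables (G : groupType) (f : 'I_3 -> G) (G2 : class2 G).

Lemma central_zexpg x y n z : zexpg [~ x, y] n * z = z * zexpg [~ x, y] n :> G.
Proof. exact/commute_sym/commute_zexpg/commute_sym/G2. Qed.

Lemma class2_zexpg_mulV x y n :
  zexpg y n / x = x^-1 * zexpg y n * zexpg [~ y, x] (- n)%R :> G.
Proof. by rewrite class2_zexpg_mul // class2_commgV // zexpgV. Qed.

(** Here and below x stands for a generator (e = 1) or its inverse (e = -1); the
    hypotheses are what both cases have in common. *)
Lemma normal_form_mul3 (x : G) (e : int) a1 a2 a3 q21 q31 q32 :
  (forall n, zexpg (f i3) n * x = zexpg (f i3) (n + e)) ->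
  normal_form f a1 a2 a3 q21 q31 q32 * x =
  normal_form f a1 a2 (a3 + e) q21 q31 q32.
Proof.
move=> xE; rewrite /normal_form -xE -!mulgA; do 3 congr (_ * _).
rewrite [zexpg _ q32 * x]central_zexpg [zexpg _ q31 * (x * _)]mulgA.
rewrite [zexpg _ q31 * x]central_zexpg -!mulgA [zexpg _ q21 * (x * _)]mulgA.
by rewrite [zexpg _ q21 * x]central_zexpg -!mulgA.
Qed.

Lemma normal_form_mul2 (x : G) (e : int) a1 a2 a3 q21 q31 q32 :
  (forall n, zexpg (f i2) n * x = zexpg (f i2) (n + e)) ->
  (forall n, zexpg (f i3) n * x =
     x * zexpg (f i3) n * zexpg [~ f i3, f i2] (e * n)) ->
  normal_form f a1 a2 a3 q21 q31 q32 * x =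
  normal_form f a1 (a2 + e) a3 q21 q31 (q32 + e * a3).
Proof.
move=> xE x3; rewrite /normal_form -xE zexpgD -!mulgA; do 2 congr (_ * _).
rewrite [zexpg _ q32 * x]central_zexpg [zexpg _ q31 * (x * _)]mulgA.
rewrite [zexpg _ q31 * x]central_zexpg -!mulgA [zexpg _ q21 * (x * _)]mulgA.
rewrite [zexpg _ q21 * x]central_zexpg -!mulgA [zexpg _ a3 * (x * _)]mulgA x3.
rewrite -!mulgA; do 2 congr (_ * _).
by rewrite [LHS]central_zexpg -!mulgA.
Qed.

Lemma normal_form_mul1 (x : G) (e : int) a1 a2 a3 q21 q31 q32 :
  (forall n, zexpg (f i1) n * x = zexpg (f i1) (n + e)) ->
  (forall n, zexpg (f i2) n * x =
     x * zexpg (f i2) n * zexpg [~ f i2, f i1] (e * n)) ->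
  (forall n, zexpg (f i3) n * x =
     x * zexpg (f i3) n * zexpg [~ f i3, f i1] (e * n)) ->
  normal_form f a1 a2 a3 q21 q31 q32 * x =
  normal_form f (a1 + e) a2 a3 (q21 + e * a2) (q31 + e * a3) q32.
Proof.
move=> xE x2 x3; rewrite /normal_form -xE !zexpgD -!mulgA; congr (_ * _).
rewrite [zexpg _ q32 * x]central_zexpg [zexpg _ q31 * (x * _)]mulgA.
rewrite [zexpg _ q31 * x]central_zexpg -!mulgA [zexpg _ q21 * (x * _)]mulgA.
rewrite [zexpg _ q21 * x]central_zexpg -!mulgA [zexpg _ a3 * (x * _)]mulgA x3.
rewrite -!mulgA [zexpg _ a2 * (x * _)]mulgA x2 -!mulgA; do 2 congr (_ * _).
rewrite [LHS]central_zexpg -!mulgA; congr (_ * _).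
rewrite [LHS]central_zexpg -!mulgA; congr (_ * _).
rewrite [RHS]central_zexpg -!mulgA; congr (_ * _).
by rewrite [RHS]central_zexpg -!mulgA.
Qed.

End Collection.

(** The exponents depend on the word only, not on the group: this is what lets
    the integer model below detect which words vanish in class 2. *)
Lemma class2_collection (u : free_group 'I_3) :
  exists a1 a2 a3 q21 q31 q32 : int, forall (G : groupType) (f : 'I_3 -> G),
    class2 G -> free_eval f u = normal_form f a1 a2 a3 q21 q31 q32.
Proof.
rewrite /free_eval; case: u => /= s _; elim/last_ind: s => [|s [i b] IHs].
  exists 0%R, 0%R, 0%R, 0%R, 0%R, 0%R => G f G2.
  by rewrite big_nil /normal_form /= !mulg1.
move: IHs => [a1 [a2 [a3 [q21 [q31 [q32 IHs]]]]]].
pose e : int := if b then (-1)%R else 1%R.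
have powE (G : groupType) (x : G) n :
    zexpg x n * (if b then x^-1 else x) = zexpg x (n + e).
  by rewrite /e; case: (b); rewrite ?zexpgB1 ?zexpgS.
have mulE (G : groupType) (x y : G) n : class2 G ->
    zexpg y n * (if b then x^-1 else x) =
    (if b then x^-1 else x) * zexpg y n * zexpg [~ y, x] (e * n).
  move=> G2; rewrite /e; case: (b) => /=.
    by rewrite mulN1r class2_zexpg_mulV.
  by rewrite mul1r class2_zexpg_mul.
case: (ord3P i) => {i}->.
- exists (a1 + e)%R, a2, a3, (q21 + e * a2)%R, (q31 + e * a3)%R, q32 => G f G2.
  rewrite big_rcons (IHs G f G2); apply: normal_form_mul1 => // n;
    by [exact: powE | exact: mulE].
- exists a1, (a2 + e)%R, a3, q21, q31, (q32 + e * a3)%R => G f G2.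
  rewrite big_rcons (IHs G f G2); apply: normal_form_mul2 => // n;
    by [exact: powE | exact: mulE].
- exists a1, a2, (a3 + e)%R, q21, q31, q32 => G f G2.
  by rewrite big_rcons (IHs G f G2); apply: normal_form_mul3 => // n;
    exact: powE.
Qed.

(** * A faithful integer model of class 2 and rank 3 *)

(** The set Z^3 x Lambda^2 Z^3 with product (a, p) (b, r) =
    (a + b, p + r + a /\ b), where pji is the coefficient of ej /\ ei.  Up to
    doubling p this is the Baker-Campbell-Hausdorff product, so linear maps of
    Z^3 act on it by endomorphisms, and by linear formulas; they would be
    quadratic in the normal form coordinates. *)
Definition wedge : Type := (int * int * int * int * int * int)%type.
HB.instance Definition _ := Choice.on wedge.

Definition wedge_mul (g h : wedge) : wedge :=
  let: (a1, a2, a3, p21, p31, p32) := g in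
  let: (b1, b2, b3, r21, r31, r32) := h in
  (a1 + b1, a2 + b2, a3 + b3, p21 + r21 + (a2 * b1 - a1 * b2),
   p31 + r31 + (a3 * b1 - a1 * b3), p32 + r32 + (a3 * b2 - a2 * b3))%R.

Definition wedge_inv (g : wedge) : wedge :=
  let: (a1, a2, a3, p21, p31, p32) := g in
  (- a1, - a2, - a3, - p21, - p31, - p32)%R.

Lemma wedge_mulA : associative wedge_mul.
Proof.
move=> [[[[[? ?] ?] ?] ?] ?] [[[[[? ?] ?] ?] ?] ?] [[[[[? ?] ?] ?] ?] ?].
by congr (_, _, _, _, _, _); ring.
Qed.

Lemma wedge_mul1 : left_id (0, 0, 0, 0, 0, 0)%R wedge_mul.
Proof. by move=> [[[[[? ?] ?] ?] ?] ?]; congr (_, _, _, _, _, _); ring. Qed.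

Lemma wedge_mulr1 : right_id (0, 0, 0, 0, 0, 0)%R wedge_mul.
Proof. by move=> [[[[[? ?] ?] ?] ?] ?]; congr (_, _, _, _, _, _); ring. Qed.

Lemma wedge_mulV : left_inverse (0, 0, 0, 0, 0, 0)%R wedge_inv wedge_mul.
Proof. by move=> [[[[[? ?] ?] ?] ?] ?]; congr (_, _, _, _, _, _); ring. Qed.

Lemma wedge_mulrV : right_inverse (0, 0, 0, 0, 0, 0)%R wedge_inv wedge_mul.
Proof. by move=> [[[[[? ?] ?] ?] ?] ?]; congr (_, _, _, _, _, _); ring. Qed.

HB.instance Definition _ := isGroup.Build wedge
  wedge_mulA wedge_mul1 wedge_mulr1 wedge_mulV wedge_mulrV.

Lemma wedge_mulE (a1 a2 a3 p21 p31 p32 b1 b2 b3 r21 r31 r32 : int) :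
  ((a1, a2, a3, p21, p31, p32) : wedge) * ((b1, b2, b3, r21, r31, r32) : wedge) =
  (a1 + b1, a2 + b2, a3 + b3, p21 + r21 + (a2 * b1 - a1 * b2),
   p31 + r31 + (a3 * b1 - a1 * b3), p32 + r32 + (a3 * b2 - a2 * b3))%R.
Proof. by []. Qed.

Lemma wedge_commE (a1 a2 a3 p21 p31 p32 b1 b2 b3 r21 r31 r32 : int) :
  [~ ((a1, a2, a3, p21, p31, p32) : wedge), ((b1, b2, b3, r21, r31, r32) : wedge)]
  = (0, 0, 0, 2 * (a2 * b1 - a1 * b2), 2 * (a3 * b1 - a1 * b3),
     2 * (a3 * b2 - a2 * b3))%R.
Proof. by congr (_, _, _, _, _, _); ring. Qed.

Lemma wedge_class2 : class2 wedge.
Proof.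
move=> [[[[[? ?] ?] ?] ?] ?] [[[[[? ?] ?] ?] ?] ?] [[[[[? ?] ?] ?] ?] ?].
by rewrite wedge_commE; congr (_, _, _, _, _, _); ring.
Qed.

Lemma wedge_zexpg (a1 a2 a3 p21 p31 p32 n : int) :
  zexpg ((a1, a2, a3, p21, p31, p32) : wedge) n =
  (n * a1, n * a2, n * a3, n * p21, n * p31, n * p32)%R.
Proof.
elim/int_rect: n => [|n IHn|n IHn].
- by congr (_, _, _, _, _, _); ring.
- rewrite -addn1 PoszD zexpgS IHn; congr (_, _, _, _, _, _); ring.
- rewrite -addn1 PoszD opprD zexpgB1 IHn; congr (_, _, _, _, _, _); ring.
Qed.

Definition wedge_basis (i : 'I_3) : wedge :=
  match val i with
  | 0 => (1, 0, 0, 0, 0, 0)%R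
  | 1 => (0, 1, 0, 0, 0, 0)%R
  | _ => (0, 0, 1, 0, 0, 0)%R
  end.

(** The image of the free group is the set of (a, p) with each pji congruent to
    aj ai modulo 2. *)
Lemma wedge_normal_form (a1 a2 a3 q21 q31 q32 : int) :
  normal_form wedge_basis a1 a2 a3 q21 q31 q32 =
  (a1, a2, a3, 2 * q21 - a1 * a2, 2 * q31 - a1 * a3, 2 * q32 - a2 * a3)%R.
Proof.
rewrite /normal_form !wedge_commE !wedge_zexpg !wedge_mulE.
by congr (_, _, _, _, _, _); ring.
Qed.

Local Notation G32 := (free_nilpotent 'I_3 2).
Local Notation pi32 := (quo_pi (lower_central_nsg (free_group 'I_3) 3)).

Lemma free_nilpotent_class2 : class2 G32.
Proof.
move=> x y z; have [u <-] := quo_pi_surj x; have [v <-] := quo_pi_surj y.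
have [t <-] := quo_pi_surj z.
apply/commgP/eqP; rewrite -!gmulfR; apply/quo_pi_eq1 => A HA; apply: HA.2.
by exists [~ u, v] => [B HB|]; [apply: HB.2; exists u => //; exists v | exists t].
Qed.

(** The model determines the exponents of the normal form, and the normal form
    holds in the free nilpotent group too. *)
Lemma wedge_faithful (u : free_group 'I_3) :
  free_eval wedge_basis u = 1 -> pi32 u = 1.
Proof.
have [a1 [a2 [a3 [q21 [q31 [q32 uE]]]]]] := class2_collection u.
rewrite (uE _ _ wedge_class2) wedge_normal_form => -[a10 a20 a30 e21 e31 e32].
have [q10 [q20 q30]] : q21 = 0%R /\ q31 = 0%R /\ q32 = 0%R.
  by move: e21 e31 e32; rewrite a10 a20 a30; lia.
have -> : pi32 u = free_eval (pi32 \o @free_gen _) u.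
  by apply: (free_eval_unique (h := pi32)) => //; exact: gmulfM.
by rewrite (uE _ _ free_nilpotent_class2) a10 a20 a30 q10 q20 q30
  /normal_form /= !mulg1.
Qed.

(** * Unimodular vectors orthogonal to given ones *)

Lemma bezout_orthogonal (a b : int) :
  exists y z l m : int, (l * y + m * z = 1 /\ a * y + b * z = 0)%R.
Proof.
have [[-> ->]|nz] := eqVneq (a, b) (0, 0)%R.
  by exists 1%R, 0%R, 1%R, 0%R; lia.
have [u [v uv]] := Bezoutz a b.
have g0 : gcdz a b != 0%R.
  by apply: contra nz; rewrite gcdz_eq0 => /andP[/eqP-> /eqP->].
have [a' aE] := dvdzP (dvdz_gcdl a b).
have [b' bE] := dvdzP (dvdz_gcdr a b).
exists (- b')%R, a', (- v)%R, u; move: (gcdz a b) uv g0 aE bE => g uv g0 aE bE.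
split; last by rewrite aE bE; ring.
by apply: (mulIf g0); rewrite mul1r -[RHS]uv aE bE; ring.
Qed.

(** The covectors f = (0, y, z) and g = (y', -z' m, z' l) annihilate a and have
    dual vectors F = (0, l, m) and G = (l', -z m', y m').  The covector looked for
    is taken in the span of f and g, the vector in the span of F and G, which
    reduces the problem to rank 2. *)
Lemma bezout_orthogonal3 (a1 a2 a3 p1 p2 p3 : int) :
  exists y1 y2 y3 l1 l2 l3 : int,
  [/\ l1 * y1 + l2 * y2 + l3 * y3 = 1, l1 * a1 + l2 * a2 + l3 * a3 = 0
    & p1 * y1 + p2 * y2 + p3 * y3 = 0]%R.
Proof.
have [y [z [l [m [yz1 yz0]]]]] := bezout_orthogonal a2 a3.
have [y' [z' [l' [m' [yz1' yz0']]]]] := bezout_orthogonal a1 (l * a3 - m * a2)%R.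
pose G1 := l'; pose G2 := (- z * m')%R; pose G3 := (y * m')%R.
have [s [t [c [d [st1 st0]]]]] :=
  bezout_orthogonal (p2 * l + p3 * m)%R (p1 * G1 + p2 * G2 + p3 * G3)%R.
exists (t * G1)%R, (s * l + t * G2)%R, (s * m + t * G3)%R.
exists (d * y')%R, (c * y - d * z' * m)%R, (c * z + d * z' * l)%R.
rewrite /G1 /G2 /G3 in st0 *; split.
- transitivity (c * s * (l * y + m * z)
      + d * t * (l' * y' + m' * z' * (l * y + m * z)))%R; first by ring.
  by rewrite yz1 !mulr1 yz1' mulr1.
- transitivity (c * (a2 * y + a3 * z)
      + d * (a1 * y' + (l * a3 - m * a2) * z'))%R; first by ring.
  by rewrite yz0 yz0'; ring.
- by rewrite -[RHS]st0; ring.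
Qed.

(** * Reflections and inverting endomorphisms *)

Section Reflection.
Variables y1 y2 y3 l1 l2 l3 : int.

(** M = -1 + 2 y l on vectors and Lambda^2 M on bivectors.  The latter is
    p - 2 y /\ k, where k is the contraction of p by l: this formula is
    multiplicative for all y and l, even when l(y) is not 1. *)
Definition reflection (g : wedge) : wedge :=
  let: (a1, a2, a3, p21, p31, p32) := g in
  (2 * (l1 * a1 + l2 * a2 + l3 * a3) * y1 - a1,
   2 * (l1 * a1 + l2 * a2 + l3 * a3) * y2 - a2,
   2 * (l1 * a1 + l2 * a2 + l3 * a3) * y3 - a3,
   p21 - 2 * (y2 * (l2 * p21 + l3 * p31) - y1 * (l3 * p32 - l1 * p21)),
   p31 - 2 * (y3 * (l2 * p21 + l3 * p31) + y1 * (l1 * p31 + l2 * p32)),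
   p32 - 2 * (y3 * (l3 * p32 - l1 * p21) + y2 * (l1 * p31 + l2 * p32)))%R.

Lemma reflection_div : {morph reflection : g h / g / h}.
Proof.
move=> [[[[[? ?] ?] ?] ?] ?] [[[[[? ?] ?] ?] ?] ?].
by congr (_, _, _, _, _, _); ring.
Qed.

HB.instance Definition _ := isGroupMorphism.Build wedge wedge reflection
  reflection_div.

(** Contracting y /\ p = 0 by l gives p = y /\ k as l(y) = 1, so that
    p - 2 y /\ k = -p.  The third hypothesis is y /\ p = 0 in coordinates. *)
Lemma reflection_inverts (a1 a2 a3 p21 p31 p32 : int) :
  (l1 * y1 + l2 * y2 + l3 * y3 = 1)%R -> (l1 * a1 + l2 * a2 + l3 * a3 = 0)%R ->
  (p32 * y1 + - p31 * y2 + p21 * y3 = 0)%R ->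
  reflection (a1, a2, a3, p21, p31, p32) =
  ((a1, a2, a3, p21, p31, p32) : wedge)^-1.
Proof.
move=> ly la py; rewrite /reflection la; congr (_, _, _, _, _, _); try ring.
- transitivity (p21 - 2 * p21 * (l1 * y1 + l2 * y2 + l3 * y3)
    + 2 * l3 * (p32 * y1 + - p31 * y2 + p21 * y3))%R; first by ring.
  by rewrite ly py; ring.
- transitivity (p31 - 2 * p31 * (l1 * y1 + l2 * y2 + l3 * y3)
    - 2 * l2 * (p32 * y1 + - p31 * y2 + p21 * y3))%R; first by ring.
  by rewrite ly py; ring.
- transitivity (p32 - 2 * p32 * (l1 * y1 + l2 * y2 + l3 * y3)
    + 2 * l1 * (p32 * y1 + - p31 * y2 + p21 * y3))%R; first by ring.
  by rewrite ly py; ring.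
Qed.

(** The vector M ei has at most one odd coordinate, as M = -1 modulo 2; hence the
    products of two of its coordinates are even and (M ei, 0) comes from the free
    group. *)
Lemma reflection_basis_lift (i : 'I_3) :
  exists u : free_group 'I_3,
    free_eval wedge_basis u = reflection (wedge_basis i).
Proof.
have nfE (a1 a2 a3 q21 q31 q32 : int) :
    free_eval wedge_basis (normal_form (@free_gen _) a1 a2 a3 q21 q31 q32) =
    (a1, a2, a3, 2 * q21 - a1 * a2, 2 * q31 - a1 * a3, 2 * q32 - a2 * a3)%R.
  rewrite normal_form_morph (_ : _ \o _ = wedge_basis) ?wedge_normal_form //.
  by apply: funext => j /=; rewrite free_eval_gen.
pose lift a1 a2 a3 q21 q31 q32 := normal_form (@free_gen _) a1 a2 a3 q21 q31 q32.
case: (ord3P i) => ->.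
- exists (lift (2 * l1 * y1 - 1) (2 * l1 * y2) (2 * l1 * y3)
    ((2 * l1 * y1 - 1) * l1 * y2) ((2 * l1 * y1 - 1) * l1 * y3)
    (2 * l1 * y2 * l1 * y3))%R.
  by rewrite nfE; congr (_, _, _, _, _, _); ring.
- exists (lift (2 * l2 * y1) (2 * l2 * y2 - 1) (2 * l2 * y3)
    ((2 * l2 * y2 - 1) * l2 * y1) (2 * l2 * y1 * l2 * y3)
    ((2 * l2 * y2 - 1) * l2 * y3))%R.
  by rewrite nfE; congr (_, _, _, _, _, _); ring.
- exists (lift (2 * l3 * y1) (2 * l3 * y2) (2 * l3 * y3 - 1)
    (2 * l3 * y1 * l3 * y2) ((2 * l3 * y3 - 1) * l3 * y1)
    ((2 * l3 * y3 - 1) * l3 * y2))%R.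
  by rewrite nfE; congr (_, _, _, _, _, _); ring.
Qed.

End Reflection.

Lemma inverting_substitution (u : free_group 'I_3) :
  exists t : 'I_3 -> free_group 'I_3, pi32 (free_eval t u) = (pi32 u)^-1.
Proof.
case uE: (free_eval wedge_basis u) => [[[[[a1 a2] a3] p21] p31] p32].
have [y1 [y2 [y3 [l1 [l2 [l3 [ly la py]]]]]]] :=
  bezout_orthogonal3 a1 a2 a3 p32 (- p31)%R p21.
have [t tE] := choice (reflection_basis_lift y1 y2 y3 l1 l2 l3).
exists t; apply/esym/mulg1_eq; rewrite -gmulfM; apply: wedge_faithful.
rewrite gmulfM /= -free_eval_comp.
rewrite (_ : _ \o t = reflection y1 y2 y3 l1 l2 l3 \o wedge_basis).
  by rewrite free_eval_comp /= uE reflection_inverts // mulgV.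
by apply: funext => i /=; rewrite tE.
Qed.

(** Word values are closed under endomorphisms; substituting t into the free
    group elements representing the arguments realises the one that inverts the
    given value. *)
Lemma word_image_inv_sub (k : nat) (w : free_group 'I_k) v :
  word_image G32 w v -> word_image G32 w^-1 v.
Proof.
move=> [g _ <-].
have [u uE] := choice (fun i => quo_pi_surj (g i)).
have -> : g = pi32 \o u by apply: funext => i /=; rewrite uE.
have [t tE] := inverting_substitution (free_eval u w).
exists (pi32 \o (free_eval t \o u)) => //.
by rewrite gmulfV /= !free_eval_comp /= tE invgK.
Qed.

Lemma free_nilpotent_achiral : achiral G32.
Proof.
move=> [k [w]]; apply; apply/seteqP; split=> v; first exact: word_image_inv_sub.
by move=> /word_image_inv_sub; rewrite invgK.
Qed.

Theorem theorem3 :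
  (forall (X : choiceType) (c : nat),
     (exists x y : X, x <> y) -> (3 <= c)%N -> chiral (free_nilpotent X c)) /\
  achiral (free_nilpotent 'I_3 2).
Proof. exact: (conj free_nilpotent_chiral free_nilpotent_achiral). Qed.
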